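(* Let $G=\mathbb{Z}_2^3$, let $F:G\times G\to\mathbb{R}^*$ be $$F(x,y)=(-1)^{x_1x_2y_3+x_1y_2x_3+y_1x_2x_3+\sum_{1\le i\le j\le 3}x_iy_j},$$ and regard the octonion algebra $\mathbb{O}=\mathbb{R}_F[G]$ as an algebra in $\mathrm{Vec}_G^{\partial F}$. Then $\mathbb{O}$ is an Azumaya algebra in the braided linear Gr-category $(\mathrm{Vec}_{G}^{\partial F},\mathcal{R})$ with $$\mathcal{R}(x,y)=(-1)^{x_1x_2y_3+x_1y_2x_3+y_1x_2x_3+y_1y_2x_3+y_1x_2y_3+x_1y_2y_3+\sum_{i,j=1}^{3}x_iy_j},\qquad \forall x,y\in G.$$
   Context: All vector spaces are over $\mathbb{R}$. $\mathbb{Z}_2=\{0,1\}$, $G=\mathbb{Z}_2^3$ is written additively, and $x=(x_1,x_2,x_3)$, $y=(y_1,y_2,y_3)\in G$. For a normalized 3-cocycle $\Phi:G^3\to\mathbb{R}^*$, the linear Gr-category $\mathrm{Vec}_G^{\Phi}$ is the tensor category of finite-dimensional $G$-graded real vector spaces, with the usual graded tensor product and associativity constraint $(u\otimes v)\otimes w\mapsto \Phi(x,y,z)\,u\otimes(v\otimes w)$ for $u,v,w$ homogeneous of degrees $x,y,z$. A braiding of $\mathrm{Vec}_G^\Phi$ is given by a quasi-bicharacter with respect to $\Phi$, i.e. a function $\mathcal{R}:G\times G\to\mathbb{R}^*$ with $$\mathcal{R}(x+y,z)=\mathcal{R}(x,z)\mathcal{R}(y,z)\frac{\Phi(z,x,y)\Phi(x,y,z)}{\Phi(x,z,y)},\qquad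 \mathcal{R}(x,y+z)=\mathcal{R}(x,y)\mathcal{R}(x,z)\frac{\Phi(y,x,z)}{\Phi(y,z,x)\Phi(x,y,z)}$$ for all $x,y,z\in G$; the braiding is $u\otimes v\mapsto \mathcal{R}(x,y)\,v\otimes u$ for $u,v$ homogeneous of degrees $x,y$. For a 2-cochain $F:G\times G\to\mathbb{R}^*$ (with $F(0,x)=F(x,0)=1$), $\partial F(x,y,z)=\dfrac{F(x,y)F(x+y,z)}{F(x,y+z)F(y,z)}$. The twisted group algebra $\mathbb{R}_F[G]$ is the real vector space with basis $G$ (the basis element $x$ having degree $x$) and product $x\cdot y=F(x,y)(x+y)$, where on the right $x+y$ denotes the basis element indexed by the sum. For the $F$ in the claim, the octonion algebra $\mathbb{O}$ is identified with $\mathbb{R}_F[G]$. An algebra in $\mathrm{Vec}_G^{\Phi}$ is a finite-dimensional $G$-graded space $A$ with a degree-preserving unital multiplication satisfying $(a\cdot b)\cdot c=\Phi(|a|,|b|,|c|)\,a\cdot(b\cdot c)$ for homogeneous $a,b,c$, where $|a|$ is the degree of $a$. Azumaya algebras are understood in the general sense for braided monoidal categories (Van Oystaeyen–Zhang), which in the present setting reads: a nonzero algebra $A$ in $(\mathrm{Vec}_G^{\Phi},\mathcal{R})$ is Azumaya if the two linear maps $A\otimes A\to\mathrm{End}_{\mathbb{R}}(A)$ determined on homogeneous elements by $$a\otimes b\mapsto\big(t\mapsto \Phi(|a|,|b|,|t|)\,\mathcal{R}(|b|,|t|)\;a\cdot(t\cdot b)\big),\qquad a\otimes b\mapsto\big(t\mapsto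 \Phi(|t|,|a|,|b|)^{-1}\,\mathcal{R}(|t|,|a|)\;(a\cdot t)\cdot b\big)$$ are both bijective (these are the canonical morphisms from $A\otimes\overline{A}$ and $\overline{A}\otimes A$ to the two internal endomorphism objects of $A$, where $\overline{A}$ is the braided opposite algebra). *)

(* Defs.v *)
From HB Require Import structures.
From mathcomp Require Import all_boot all_order all_algebra.
From mathcomp Require Import mxtens reals.

Set Implicit Arguments.
Unset Strict Implicit.
Unset Printing Implicit Defensive.

Import GRing.Theory.
Local Open Scope ring_scope.

(* Functions with values in the multiplicative group K^* are represented as
   functions with values in K together with an explicit non-vanishing
   condition. *)

Section GrCategory.
Variables (K : fieldType) (G : finZmodType).

Definition normalized_cocycle3 (Phi : G -> G -> G -> K) : Prop :=
  [/\ forall x y z, Phi x y z != 0,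
      forall x y, [/\ Phi 0 x y = 1, Phi x 0 y = 1 & Phi x y 0 = 1]
    & forall x y z t,
        Phi y z t * Phi x (y + z) t * Phi x y z
        = Phi (x + y) z t * Phi x y (z + t)].

Definition quasi_bicharacter (Phi : G -> G -> G -> K) (Br : G -> G -> K) :
    Prop :=
  [/\ forall x y, Br x y != 0,
      forall x y z, Br (x + y) z =
        Br x z * Br y z * (Phi z x y * Phi x y z / Phi x z y)
    & forall x y z, Br x (y + z) =
        Br x y * Br x z * (Phi y x z / (Phi y z x * Phi x y z))].

(* (Phi, Br) are the structure constants of a braided linear Gr-category:
   associator (u (x) v) (x) w |-> Phi x y z u (x) (v (x) w) and braiding
   u (x) v |-> Br x y v (x) u on homogeneous vectors of degrees x, y, z. *)
Definition braided_gr_category (Phi : G -> G -> G -> K) (Br : G -> G -> K) :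
    Prop :=
  normalized_cocycle3 Phi /\ quasi_bicharacter Phi Br.

(* Data only; the laws are in [algebra_in]. *)
Record graded_magma := GradedMagma {
  carrier :> vectType K;
  homog : G -> {vspace carrier};
  gmul : carrier -> carrier -> carrier;
  gone : carrier
}.

Definition algebra_in (Phi : G -> G -> G -> K) (A : graded_magma) : Prop :=
  [/\ directv (\sum_x homog A x) /\ (\sum_x homog A x)%VS = fullv,
      (forall a : A, linear (gmul a)) /\
        (forall b : A, linear ((@gmul A)^~ b)),
      gone A \in homog A 0 /\
        (forall a : A, gmul (gone A) a = a /\ gmul a (gone A) = a),
      forall x y (a b : A), a \in homog A x -> b \in homog A y ->
        gmul a b \in homog A (x + y)
    & forall x y z (a b c : A),
        a \in homog A x -> b \in homog A y -> c \in homog A z ->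
        gmul (gmul a b) c = Phi x y z *: gmul a (gmul b c)].

(* The tensor product of finite-dimensional spaces, modelled in coordinates:
   u (x) v is the Kronecker product of the coordinate vectors of u and v in
   the bases [vbasis fullv] of U and V.  See [tens_universal]. *)
Definition tensor_space (U V : vectType K) : vectType K :=
  'rV[K]_(\dim {:U} * \dim {:V}).

Definition tens (U V : vectType K) (u : U) (v : V) : tensor_space U V :=
  passmx.rVof (vbasis {:U}) u *t passmx.rVof (vbasis {:V}) v.

Lemma tensE (U V : vectType K) (u : U) (v : V) i j :
  (tens u v : 'rV_(_ * _)) 0 (mxtens_index (i, j))
  = coord (vbasis {:U}) i u * coord (vbasis {:V}) j v.
Proof. by rewrite /tens !mxE mxtens_indexK. Qed.

Lemma tens_linearl (U V : vectType K) (v : V) :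
  linear ((@tens U V)^~ v).
Proof.
move=> c u u'; apply/matrixP=> i j /=.
by rewrite /tens passmx.rVof_linear !(tensmxE, mxE) mulrDl mulrA.
Qed.

Lemma tens_linearr (U V : vectType K) (u : U) : linear (@tens U V u).
Proof.
move=> c v v'; apply/matrixP=> i j /=.
by rewrite /tens passmx.rVof_linear !(tensmxE, mxE) mulrDr mulrCA.
Qed.

Lemma tens_universal (U V W : vectType K) (f : U -> V -> W) :
  (forall u, linear (f u)) -> (forall v, linear (f^~ v)) ->
  exists! L : 'Hom(tensor_space U V, W), forall u v, L (tens u v) = f u v.
Proof.
move=> fr fl.
pose eU := vbasis {:U}; pose eV := vbasis {:V}.
pose g (m : tensor_space U V) : W :=
  \sum_i \sum_j (m : 'rV_(_ * _)) 0 (mxtens_index (i, j)) *: f eU`_i eV`_j.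
have glin : linear g.
  move=> c m m'; rewrite /g scaler_sumr -big_split; apply: eq_bigr => i _ /=.
  rewrite scaler_sumr -big_split; apply: eq_bigr => j _ /=.
  by rewrite !mxE scalerDl scalerA.
pose Gl := GRing.isLinear.Build K (tensor_space U V) W *:%R g glin.
pose gL : {linear tensor_space U V -> W} := HB.pack g Gl.
pose f2 u : {linear V -> W} :=
  HB.pack (f u) (GRing.isLinear.Build K V W *:%R (f u) (fr u)).
pose f1 v : {linear U -> W} :=
  HB.pack (f^~ v) (GRing.isLinear.Build K U W *:%R (f^~ v) (fl v)).
have fE u v : f u v
    = \sum_i \sum_j (coord eU i u * coord eV j v) *: f eU`_i eV`_j.
  rewrite -[LHS]/(f1 v u) {1}(coord_vbasis (memvf u)) linear_sum.
  apply: eq_bigr => i _; rewrite linearZ /= -[f _ v]/(f2 _ v).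
  rewrite {1}(coord_vbasis (memvf v)) linear_sum scaler_sumr.
  by apply: eq_bigr => j _; rewrite linearZ scalerA.
have gE u v : g (tens u v) = f u v.
  rewrite fE; apply: eq_bigr => i _; apply: eq_bigr => j _; congr (_ *: _).
  by rewrite tensE.
have deltaE (i : 'I_(\dim {:U})) (j : 'I_(\dim {:V})) :
    tens eU`_i eV`_j = delta_mx 0 (mxtens_index (i, j)).
  apply/rowP=> l; rewrite -[l]mxtens_unindexK.
  case: (mxtens_unindex l) => i' j'.
  rewrite tensE !coord_free ?(basis_free (vbasisP _)) // mxE eqxx /=.
  rewrite (can_eq (@mxtens_indexK _ _)) xpair_eqE -natrM mulnb.
  by rewrite (eq_sym i) (eq_sym j).
exists (linfun gL); split=> [u v|L LE]; first by rewrite lfunE; exact: gE.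
apply/lfunP => m; rewrite lfunE /= /g.
rewrite [in RHS](row_sum_delta m) linear_sum /=.
rewrite pair_big (reindex (@mxtens_unindex _ _)) /=; last first.
  exists (@mxtens_index _ _) => k _; [exact: mxtens_unindexK|exact: mxtens_indexK].
apply: eq_bigr => k _; rewrite linearZ /=.
rewrite -[X in mxtens_index X]/(mxtens_unindex k) mxtens_unindexK -LE.
congr (_ *: L _).
etransitivity; first exact: (deltaE (mxtens_unindex k).1 (mxtens_unindex k).2).
by rewrite -surjective_pairing mxtens_unindexK.
Qed.

(* Homogeneous vectors span A, so the conditions below determine L uniquely. *)

Definition is_left_canonical (Phi : G -> G -> G -> K) (Br : G -> G -> K)
    (A : graded_magma) (L : 'Hom(tensor_space A A, 'End(A))) : Prop :=
  forall x y z (a b t : A),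
    a \in homog A x -> b \in homog A y -> t \in homog A z ->
    L (tens a b) t = (Phi x y z * Br y z) *: gmul a (gmul t b).

Definition is_right_canonical (Phi : G -> G -> G -> K) (Br : G -> G -> K)
    (A : graded_magma) (L : 'Hom(tensor_space A A, 'End(A))) : Prop :=
  forall x y z (a b t : A),
    a \in homog A x -> b \in homog A y -> t \in homog A z ->
    L (tens a b) t = ((Phi z x y)^-1 * Br z x) *: gmul (gmul a t) b.

Definition azumaya (Phi : G -> G -> G -> K) (Br : G -> G -> K)
    (A : graded_magma) : Prop :=
  [/\ algebra_in Phi A,
      (fullv : {vspace A}) != 0%VS,
      exists2 L : 'Hom(tensor_space A A, 'End(A)),
        is_left_canonical Phi Br L & bijective L
    & exists2 L : 'Hom(tensor_space A A, 'End(A)),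
        is_right_canonical Phi Br L & bijective L].

Definition coboundary2 (F : G -> G -> K) (x y z : G) : K :=
  (F x y * F (x + y) z) / (F x (y + z) * F y z).

Definition basis_elt (x : G) : {ffun G -> K^o} := [ffun z => (z == x)%:R].

Definition twisted_mul (F : G -> G -> K) (a b : {ffun G -> K^o}) :
    {ffun G -> K^o} :=
  \sum_x \sum_y (a x * b y * F x y) *: basis_elt (x + y).

Definition twisted_group_algebra (F : G -> G -> K) : graded_magma :=
  @GradedMagma {ffun G -> K^o} (fun x => <[basis_elt x]>%VS)
    (twisted_mul F) (basis_elt 0).

End GrCategory.

Definition Z2cube : finZmodType := 'rV['Z_2]_3.

(* The coordinates x_1, x_2, x_3 in {0, 1}, as natural numbers, are
   [coord3 x 0], [coord3 x 1], [coord3 x 2]. *)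
Definition coord3 (x : Z2cube) (i : 'I_3) : nat := (x : 'rV['Z_2]_3) 0 i.

Definition oct_exponent (x y : Z2cube) : nat :=
  let x1 := coord3 x 0 in let x2 := coord3 x 1 in let x3 := coord3 x 2 in
  let y1 := coord3 y 0 in let y2 := coord3 y 1 in let y3 := coord3 y 2 in
  (x1 * x2 * y3 + x1 * y2 * x3 + y1 * x2 * x3
   + \sum_(i < 3) \sum_(j < 3 | i <= j) coord3 x i * coord3 y j)%N.

Definition oct_cochain (R : realType) (x y : Z2cube) : R :=
  (-1) ^+ oct_exponent x y.

Definition braiding_exponent (x y : Z2cube) : nat :=
  let x1 := coord3 x 0 in let x2 := coord3 x 1 in let x3 := coord3 x 2 in
  let y1 := coord3 y 0 in let y2 := coord3 y 1 in let y3 := coord3 y 2 in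
  (x1 * x2 * y3 + x1 * y2 * x3 + y1 * x2 * x3
   + y1 * y2 * x3 + y1 * x2 * y3 + x1 * y2 * y3
   + \sum_(i < 3) \sum_(j < 3) coord3 x i * coord3 y j)%N.

Definition oct_braiding (R : realType) (x y : Z2cube) : R :=
  (-1) ^+ braiding_exponent x y.

Definition octonions (R : realType) : graded_magma R Z2cube :=
  twisted_group_algebra (@oct_cochain R).

(* Main.v *)
Require Import Defs.
From mathcomp Require Import all_boot all_order all_algebra.
From mathcomp Require Import reals.
From mathcomp Require Import ring.
From HB Require Import structures.

(** Put [B x y = R x y * F y x / F x y]: twisting by [F] trivialises the
    associator [dF], so [B] is an ordinary bicharacter, and here it is
    [(-1) ^ (x_1 y_1 + x_2 y_2 + x_3 y_3)].  On basis elements the two canonical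
    maps send [a (x) b] to
    [t |-> F(a,b) F(a+b,t) B(b,t) (a+b+t)] and
    [t |-> F(a,b) F(t,a+b) B(t,a) (a+b+t)].  For fixed [a + b], these are, up
    to rescaling rows and columns, the character table of [G], which is
    invertible because [B] is nondegenerate. *)

Import GRing.Theory Num.Theory.
Local Open Scope ring_scope.
Set Implicit Arguments.
Unset Strict Implicit.
Unset Printing Implicit Defensive.

(** * Linear algebra and character sums *)

(** Rank-nullity forces a zero kernel, so for the canonical maps it is enough to exhibit
    preimages. *)
Lemma surj_lfun_bij (K : fieldType) (U V : vectType K) (f : 'Hom(U, V)) :
  \dim {:U} = \dim {:V} -> (forall v, exists u, f u = v) -> bijective f.
Proof.
move=> dimUV fsurj.
have img : limg f = fullv.
  apply/eqP; rewrite eqEsubv subvf /=; apply/subvP => v _.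
  by have [u <-] := fsurj v; rewrite memv_img ?memvf.
have ker0 : lker f == 0%VS.
  rewrite -dimv_eq0 -(eqn_add2r (\dim (limg f))) add0n.
  by rewrite -{1}(capfv (lker f)) limg_ker_dim img dimUV.
exists (f^-1)%VF; first exact: lker0_lfunK.
by move=> v; rewrite limg_lfunVK // img memvf.
Qed.

Lemma tensZ (K : fieldType) (U V : vectType K) (c d : K) (u : U) (v : V) :
  tens (c *: u) (d *: v) = (c * d) *: tens u v.
Proof.
pose f : {linear U -> tensor_space U V} := HB.pack ((@tens K U V)^~ (d *: v))
  (GRing.isLinear.Build K U (tensor_space U V) *:%R _ (tens_linearl (d *: v))).
pose g : {linear V -> tensor_space U V} := HB.pack (@tens K U V u)
  (GRing.isLinear.Build K V (tensor_space U V) *:%R _ (tens_linearr u)).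
by rewrite -scalerA -[d *: tens u v](linearZ_LR g d v) -(linearZ_LR f c u).
Qed.

(** Translating the index by [x0] multiplies the sum by [chi x0]; if the sum were nonzero it could
    be cancelled, giving [chi x0 = 1]. *)
Lemma sum_character (K : fieldType) (G : finZmodType) (chi : G -> K) :
  {morph chi : x y / x + y >-> x * y} -> (exists x, chi x != 1) ->
  \sum_x chi x = 0.
Proof.
move=> chiD [x0 x0_neq1]; apply/eqP; move: x0_neq1; apply: contraR => s_neq0.
rewrite -(inj_eq (mulIf s_neq0)) mul1r mulr_sumr.
rewrite [eqbRHS](reindex_inj (addrI x0)).
by apply/eqP; apply: eq_bigr => x _; rewrite chiD.
Qed.

(** * The twisted group algebra and its endomorphisms *)

Section TwistedGroupAlgebra.
Variables (K : fieldType) (G : finZmodType) (F : G -> G -> K).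
Hypothesis F_neq0 : forall x y, F x y != 0.
Hypothesis F0x : forall x, F 0 x = 1.
Hypothesis Fx0 : forall x, F x 0 = 1.

Let A : vectType K := {ffun G -> K^o}.
Let e : G -> A := @basis_elt K G.

Lemma coboundary2_cocycle : normalized_cocycle3 (coboundary2 F).
Proof.
split=> [x y z|x y|x y z t]; rewrite /coboundary2.
- by rewrite mulf_neq0 ?invr_eq0 ?mulf_neq0.
- by rewrite !(F0x, Fx0, add0r, addr0, mul1r, mulr1) !divff.
- rewrite !addrA; field.
  by rewrite !F_neq0.
Qed.

Lemma basis_eltE x z : e x z = (z == x)%:R.
Proof. exact: ffunE. Qed.

Lemma basis_elt_sum (a : A) : a = \sum_x (a x : K) *: e x.
Proof.
apply/ffunP => z; rewrite sum_ffunE (bigD1 z) //= !ffunE eqxx big1 ?addr0.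
  by rewrite [RHS]mulr1.
by move=> x /negPf xz; rewrite !ffunE eq_sym xz; exact: mulr0.
Qed.

Lemma sum_basis_elt (V : lmodType K) x (g : G -> V) :
  \sum_z (e x z : K) *: g z = g x.
Proof.
rewrite (bigD1 x) //= basis_eltE eqxx scale1r big1 ?addr0 // => z /negPf zx.
by rewrite basis_eltE zx scale0r.
Qed.

Lemma linear_ext (W : vectType K) (g : G -> W) :
  exists h : 'Hom(A, W), forall x, h (e x) = g x.
Proof.
pose f (a : A) := \sum_x (a x : K) *: g x.
have fL : linear f.
  move=> c a b; rewrite /f scaler_sumr -big_split; apply: eq_bigr => x _ /=.
  by rewrite !ffunE scalerA -scalerDl.
pose fl : {linear A -> W} := HB.pack f (GRing.isLinear.Build K A W *:%R f fL).
by exists (linfun fl) => x; rewrite lfunE; exact: sum_basis_elt.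
Qed.

Lemma bilinear_ext (W : vectType K) (g : G -> G -> W) :
  exists L : 'Hom(tensor_space A A, W),
    forall x y, L (tens (e x) (e y)) = g x y.
Proof.
pose f (a b : A) := \sum_x \sum_y ((a x : K) * (b y : K)) *: g x y.
have fr a : linear (f a).
  move=> c b b'; rewrite /f scaler_sumr -big_split; apply: eq_bigr => x _ /=.
  rewrite scaler_sumr -big_split; apply: eq_bigr => y _ /=.
  by rewrite !ffunE scalerA -scalerDl mulrDr mulrCA.
have fl b : linear (f^~ b).
  move=> c a a'; rewrite /f scaler_sumr -big_split; apply: eq_bigr => x _ /=.
  rewrite scaler_sumr -big_split; apply: eq_bigr => y _ /=.
  by rewrite !ffunE scalerA -scalerDl mulrDl mulrA.
have [L [LE _]] := tens_universal fr fl.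
exists L => x y; rewrite LE /f.
under eq_bigr => z _ do
  (under eq_bigr => w _ do rewrite -scalerA;
   rewrite -scaler_sumr sum_basis_elt).
exact: sum_basis_elt.
Qed.

Lemma lfun_basis_ext (W : vectType K) (f g : 'Hom(A, W)) :
  (forall x, f (e x) = g (e x)) -> f = g.
Proof.
move=> fg; apply/lfunP => a; rewrite (basis_elt_sum a) !linear_sum.
by apply: eq_bigr => x _; rewrite !linearZ /= fg.
Qed.

(** [L] respects degrees: the tensors [e x], [e (s - x)] go to maps shifting degree by [s].
    Bijectivity thus splits into one square matrix [k x (s - x) t] for each [s], with rows [x] and
    columns [t], and [kinv s] is its inverse. *)
Lemma tensor_End_bij (k kinv : G -> G -> G -> K)
    (L : 'Hom(tensor_space A A, 'End(A))) :
  (forall x y z, L (tens (e x) (e y)) (e z) = k x y z *: e (x + y + z)) ->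
  (forall s z t, \sum_x kinv s z x * k x (s - x) t = (t == z)%:R) ->
  bijective L.
Proof.
move=> LE kE; apply: surj_lfun_bij.
  by rewrite !dimvf /dim /= mul1n !dimvf.
(* The map [f] is expanded in matrix units; the unit taking [e z] to [e w] has degree [w - z], and
   the inner sum over [x] is its preimage. *)
move=> f; exists (\sum_z \sum_w (f (e z) : A) w *:
   \sum_x kinv (w - z) z x *: tens (e x) (e (w - z - x))).
apply: lfun_basis_ext => t; rewrite linear_sum sum_lfunE (bigD1 t) //=.
have termE z w : (L (\sum_x kinv (w - z) z x *: tens (e x) (e (w - z - x)))
    : 'End(A)) (e t) = (t == z)%:R *: e (w - z + t).
  rewrite linear_sum sum_lfunE -(kE (w - z)) scaler_suml; apply: eq_bigr => x _.
  by rewrite linearZ /= scale_lfunE LE scalerA subrKC.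
have rowE z : (L (\sum_w (f (e z) : A) w *:
    \sum_x kinv (w - z) z x *: tens (e x) (e (w - z - x))) : 'End(A)) (e t) =
    if t == z then f (e t) else 0.
  rewrite linear_sum sum_lfunE.
  under eq_bigr => w _ do rewrite linearZ /= scale_lfunE termE.
  case: eqP => [<-|_]; last by rewrite big1 // => w _; rewrite scale0r scaler0.
  rewrite [RHS]basis_elt_sum; apply: eq_bigr => w _.
  by rewrite scale1r subrK.
rewrite rowE eqxx big1 ?addr0 // => z; rewrite rowE eq_sym => /negPf -> //.
Qed.

Lemma twisted_mulE c d x y :
  twisted_mul F (c *: e x) (d *: e y) = (c * d * F x y) *: e (x + y).
Proof.
rewrite /twisted_mul.
(* Each coefficient is regrouped with the two Kronecker deltas in front, so that [sum_basis_elt]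
   collapses the inner and then the outer sum. *)
under eq_bigr => u _.
  under eq_bigr => v _.
    rewrite [X in X * _ * _](_ : _ = c * (e x u : K)); last by rewrite ffunE.
    rewrite [X in _ * X * _](_ : _ = d * (e y v : K)); last by rewrite ffunE.
    rewrite (_ : _ * F u v = (e x u : K) * ((e y v : K) * (c * d * F u v)));
      last by ring.
    rewrite -!scalerA; over.
  rewrite -scaler_sumr sum_basis_elt; over.
by rewrite sum_basis_elt !scalerA.
Qed.

Lemma twisted_mul_linearr a : linear (twisted_mul F a : A -> A).
Proof.
move=> c b b'; rewrite /twisted_mul scaler_sumr -big_split.
apply: eq_bigr => x _ /=; rewrite scaler_sumr -big_split.
apply: eq_bigr => y _ /=.
by rewrite !ffunE scalerA -scalerDl mulrDr mulrDl [a x * (c * _)]mulrCA !mulrA.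
Qed.

Lemma twisted_mul_linearl b : linear ((twisted_mul F)^~ b : A -> A).
Proof.
move=> c a a'; rewrite /twisted_mul scaler_sumr -big_split.
apply: eq_bigr => x _ /=; rewrite scaler_sumr -big_split.
apply: eq_bigr => y _ /=.
by rewrite !ffunE scalerA -scalerDl !mulrDl !mulrA.
Qed.

Lemma twisted_mul1l a : twisted_mul F (e 0) a = a.
Proof.
pose f : {linear A -> A} := HB.pack (twisted_mul F (e 0))
  (GRing.isLinear.Build K A A *:%R _ (twisted_mul_linearr (e 0))).
rewrite -[LHS]/(f a) -[RHS](id_lfunE a) -lfunE.
congr (fun_of_lfun _ a); apply: lfun_basis_ext => x; rewrite lfunE id_lfunE /=.
by rewrite -[e 0]scale1r -[e x in LHS]scale1r twisted_mulE F0x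
  !mul1r add0r scale1r.
Qed.

Lemma twisted_mul1r a : twisted_mul F a (e 0) = a.
Proof.
pose f : {linear A -> A} := HB.pack ((twisted_mul F)^~ (e 0))
  (GRing.isLinear.Build K A A *:%R _ (twisted_mul_linearl (e 0))).
rewrite -[LHS]/(f a) -[RHS](id_lfunE a) -lfunE.
congr (fun_of_lfun _ a); apply: lfun_basis_ext => x; rewrite lfunE id_lfunE /=.
by rewrite -[e 0]scale1r -[e x in LHS]scale1r twisted_mulE Fx0
  !mul1r addr0 scale1r.
Qed.

Lemma twisted_group_algebra_in :
  algebra_in (coboundary2 F) (twisted_group_algebra F).
Proof.
split.
- split; last first.
    apply/eqP; rewrite eqEsubv subvf /=; apply/subvP => a _.
    rewrite [a]basis_elt_sum memv_sumr // => x _.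
    by rewrite memvZ ?memv_line.
  apply/directv_sum_independent => us us_e us0 x _.
  have [c usE] := fin_all_exists (fun y => vlineP _ _ (us_e y isT)).
  (* Evaluation at [x] annihilates every summand except the multiple of [e x]. *)
  move/ffunP/(_ x): us0; rewrite sum_ffunE (bigD1 x) //= big1 => [|y /negPf yx].
    rewrite usE !ffunE eqxx addr0 => /(etrans (esym (mulr1 _))) ->.
    by rewrite scale0r.
  by rewrite usE !ffunE eq_sym yx; exact: mulr0.
- by split=> a; [exact: twisted_mul_linearr|exact: twisted_mul_linearl].
- split; first exact: memv_line.
  by move=> a; split; [exact: twisted_mul1l|exact: twisted_mul1r].
- move=> x y a b /vlineP[c ->] /vlineP[d ->] /=.
  by rewrite twisted_mulE memvZ ?memv_line.
- move=> x y z a b c /vlineP[a' ->] /vlineP[b' ->] /vlineP[c' ->] /=.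
  rewrite !twisted_mulE scalerA addrA; congr (_ *: _).
  by rewrite /coboundary2; field; rewrite !F_neq0.
Qed.

(** Provides the two canonical maps from their structure constants on basis elements. *)
Lemma trilinear_ext (k : G -> G -> G -> K) :
  exists L : 'Hom(tensor_space A A, 'End(A)), forall x y z,
    L (tens (e x) (e y)) (e z) = k x y z *: e (x + y + z).
Proof.
have /fin_all_exists[E EE] (xy : G * G) : exists f : 'End(A),
    forall z, f (e z) = k xy.1 xy.2 z *: e (xy.1 + xy.2 + z).
  exact: linear_ext.
have [L LE] := bilinear_ext (fun x y => E (x, y)).
by exists L => x y z; rewrite LE EE.
Qed.

(** * Braidings obtained by twisting a bicharacter, and the Azumaya property *)

Section Braiding.
Variables B Br : G -> G -> K.
Hypothesis B_neq0 : forall x y, B x y != 0.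
Hypothesis BDl : forall x y z, B (x + y) z = B x z * B y z.
Hypothesis BDr : forall x y z, B x (y + z) = B x y * B x z.
Hypothesis BrE : forall x y, Br x y = B x y * F x y / F y x.

(** The factor [F x y / F y x] fails to be bimultiplicative by exactly the associator terms;
    commutativity of [G] matches the remaining values of [F]. *)
Lemma twisted_quasi_bicharacter : quasi_bicharacter (coboundary2 F) Br.
Proof.
split=> [x y|x y z|x y z]; rewrite !BrE.
- by rewrite !mulf_neq0 ?invr_eq0.
- rewrite /coboundary2 BDl (addrC z x) (addrC z y); field.
  by rewrite !F_neq0.
- rewrite /coboundary2 BDr (addrC z x) (addrC y x); field.
  by rewrite !F_neq0.
Qed.

Hypothesis card_neq0 : #|G|%:R != 0 :> K.
Hypothesis B_nondegl : forall y, y != 0 -> exists x, B x y != 1.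
Hypothesis B_nondegr : forall x, x != 0 -> exists y, B x y != 1.

Lemma sum_Bl y : \sum_x B x y = (y == 0)%:R * #|G|%:R.
Proof.
have [->|y0] := eqVneq y 0; last first.
  by rewrite mul0r; apply: sum_character => [u v|];
    [exact: BDl|exact: B_nondegl].
have B0 x : B x 0 = 1.
  (* [B x 0] is idempotent and nonzero, hence 1. *)
  by apply: (mulfI (B_neq0 x 0)); rewrite -BDr addr0 mulr1.
by under eq_bigr do rewrite B0; rewrite sumr_const mul1r.
Qed.

Lemma sum_Br x : \sum_y B x y = (x == 0)%:R * #|G|%:R.
Proof.
have [->|x0] := eqVneq x 0; last first.
  by rewrite mul0r; apply: sum_character => [u v|];
    [exact: BDr|exact: B_nondegr].
have B0 y : B 0 y = 1.
  by apply: (mulfI (B_neq0 0 y)); rewrite -BDl addr0 mulr1.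
by under eq_bigr do rewrite B0; rewrite sumr_const mul1r.
Qed.

Lemma B_divr x y z : B x y / B x z = B x (y - z).
Proof. by apply: (canLR (mulfK (B_neq0 x z))); rewrite -BDr subrK. Qed.

Lemma B_divl x y z : B x z / B y z = B (x - y) z.
Proof. by apply: (canLR (mulfK (B_neq0 y z))); rewrite -BDl subrK. Qed.

(** For fixed [s = x + y], [r] rescales the rows and [q] the columns of the matrix [D x (s - x) z].
    By orthogonality the inverse of the latter is its transposed entrywise inverse divided by
    [#|G|], which yields [kinv]. *)
Lemma orthogonal_tensor_End_bij (r q : G -> G -> K) (D : G -> G -> G -> K)
    (L : 'Hom(tensor_space A A, 'End(A))) :
  (forall x y, r x y != 0) -> (forall x y, q x y != 0) ->
  (forall x y z, D x y z != 0) ->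
  (forall s t z, \sum_x D x (s - x) t / D x (s - x) z
     = (t == z)%:R * #|G|%:R) ->
  (forall x y z, L (tens (e x) (e y)) (e z)
     = (r x y * q (x + y) z * D x y z) *: e (x + y + z)) ->
  bijective L.
Proof.
move=> r0 q0 D0 D_orth LE; apply: (tensor_End_bij (kinv := fun s z x =>
  (#|G|%:R * r x (s - x) * q s z * D x (s - x) z)^-1) LE) => s z t.
transitivity (q s t / q s z / #|G|%:R * \sum_x D x (s - x) t / D x (s - x) z).
  rewrite mulr_sumr; apply: eq_bigr => x _; rewrite subrKC.
  by field; rewrite r0 q0 D0 card_neq0.
rewrite D_orth; have [->|_] := eqVneq t z; last by rewrite !mul0r mulr0.
by rewrite mul1r divff // mul1r mulVf.
Qed.

Lemma twisted_group_algebra_azumaya :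
  azumaya (coboundary2 F) Br (twisted_group_algebra F).
Proof.
split; first exact: twisted_group_algebra_in.
- apply/eqP => A0; have := memvf (e 0); rewrite A0 memv0 => /eqP/ffunP/(_ 0).
  by rewrite basis_eltE ffunE eqxx => /eqP; rewrite oner_eq0.
(* The product of [coboundary2 F x y z], [Br y z] and the constants [F z y], [F x (z + y)] of
   [a (t b)] reduces to this scalar. *)
- have [L LE] := trilinear_ext
    (fun x y z => F x y * F (x + y) z * B y z).
  exists L; last first.
    apply: orthogonal_tensor_End_bij LE => // s t z.
    under eq_bigr do rewrite B_divr.
    (* The ratio is [B (s - x) (t - z)]; the substitution of [s - x] for [x] makes it a full
       character sum. *)
    rewrite -subr_eq0 -sum_Bl [RHS](reindex_inj (subrI s)).
    by apply: eq_bigr.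
  move=> x y z a b t /vlineP[c ->] /vlineP[d ->] /vlineP[c' ->].
  rewrite linearZ /= tensZ linearZ /= scale_lfunE LE !twisted_mulE !scalerA.
  rewrite (addrC z y) addrA; congr (_ *: _).
  by rewrite BrE /coboundary2; field; rewrite !F_neq0.
(* Here the inverse associator and [Br z x] meet the constants [F x z], [F (x + z) y] of [(a t) b];
   the column factor becomes [F z (x + y)]. *)
- have [L LE] := trilinear_ext
    (fun x y z => F x y * F z (x + y) * B z x).
  exists L; last first.
    apply: (orthogonal_tensor_End_bij (q := fun s t => F t s)) LE => // s t z.
    under eq_bigr do rewrite B_divl.
    by rewrite -subr_eq0 sum_Br.
  move=> x y z a b t /vlineP[c ->] /vlineP[d ->] /vlineP[c' ->].
  rewrite linearZ /= tensZ linearZ /= scale_lfunE LE !twisted_mulE !scalerA.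
  rewrite addrAC; congr (_ *: _).
  by rewrite BrE /coboundary2 (addrC z x); field; rewrite !F_neq0.
Qed.

End Braiding.
End TwistedGroupAlgebra.

(** * Sign exponents on the cube group and the octonions *)

Definition dot_exponent (x y : Z2cube) : nat :=
  \sum_(i < 3) coord3 x i * coord3 y i.

Lemma signr_dotDl (R : pzRingType) x y z :
  (-1) ^+ dot_exponent (x + y) z
    = (-1) ^+ dot_exponent x z * (-1) ^+ dot_exponent y z :> R.
Proof.
(* Coordinates of [x + y] are reduced modulo 2, so the exponents need only agree in parity. *)
rewrite -exprD -[LHS]signr_odd -[RHS]signr_odd; congr (_ ^+ nat_of_bool _).
rewrite /dot_exponent -big_split !big_ord_recl !big_ord0 /coord3 !mxE /=.
by rewrite !(oddD, oddM, odd_mod) // !andb_addl.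
Qed.

Lemma dot_exponentC x y : dot_exponent x y = dot_exponent y x.
Proof. by apply: eq_bigr => i _; rewrite mulnC. Qed.

Lemma dot_exponent_nondeg (x : Z2cube) :
  x != 0 -> exists y, dot_exponent x y = 1%N.
Proof.
move=> x0; have [i xi] : exists i, x 0 i != 0.
  apply/existsP; apply: contra_neqT x0 => /existsPn x_eq0.
  by apply/rowP => i; rewrite mxE; apply/eqP/negbNE.
(* The unit vector at a nonzero coordinate of [x] picks out that coordinate, which is 1. *)
exists (delta_mx 0 i); rewrite /dot_exponent (bigD1 i) //= big1.
  rewrite /coord3 mxE !eqxx addn0 muln1.
  by case: (x 0 i) xi => [[|[|]]].
by move=> j /negPf ji; rewrite /coord3 mxE ji andbF muln0.
Qed.

(** Compares the quadratic part of the braiding exponent with those of [F x y] and [F y x]. The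
    square is the upper triangle plus the strict lower one, and the transposed upper triangle is the
    diagonal plus the strict lower one; the doubled term disappears in parity. *)
Lemma sum_triangles n (f : 'I_n -> 'I_n -> nat) :
  (\sum_(i < n) \sum_(j < n) f i j + \sum_(i < n) \sum_(j < n | i <= j) f j i
   = \sum_(i < n) f i i + \sum_(i < n) \sum_(j < n | i <= j) f i j
     + (\sum_(i < n) \sum_(j < n | j < i) f i j).*2)%N.
Proof.
have -> : (\sum_(i < n) \sum_(j < n) f i j
    = \sum_(i < n) \sum_(j < n | i <= j) f i j
      + \sum_(i < n) \sum_(j < n | j < i) f i j)%N.
  rewrite -big_split; apply: eq_bigr => i _ /=.
  rewrite (bigID (fun j : 'I_n => i <= j)%N) /=; congr (_ + _)%N.
  by apply: eq_bigl => j; rewrite ltnNge.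
have -> : (\sum_(i < n) \sum_(j < n | i <= j) f j i
    = \sum_(i < n) f i i + \sum_(i < n) \sum_(j < n | j < i) f i j)%N.
  rewrite (exchange_big_dep xpredT) //= -big_split; apply: eq_bigr => i _ /=.
  rewrite (bigD1 i) //=; congr (_ + _)%N.
  by apply: eq_bigl => j; rewrite ltn_neqAle andbC.
by rewrite -addnn; ring.
Qed.

Lemma oct_braidingE (R : realType) x y :
  oct_braiding R x y
    = (-1) ^+ dot_exponent x y * oct_cochain R x y / oct_cochain R y x.
Proof.
(* Clearing the denominator [F y x] leaves an equality of signs, hence of parities of exponents. *)
apply: (canRL (mulfK _)); first by rewrite signr_eq0.
rewrite /oct_braiding /oct_cochain -!exprD -[LHS]signr_odd -[RHS]signr_odd.
congr (_ ^+ nat_of_bool _); rewrite /braiding_exponent /oct_exponent /=.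
have := sum_triangles (fun i j => coord3 x i * coord3 y j)%N.
under [X in (_ + X)%N = _]eq_bigr do under eq_bigr do rewrite mulnC.
rewrite -/(dot_exponent x y) => /(congr1 odd).
(* [addbACA] separates cubic from quadratic parts, so [sum_triangles] replaces the latter. What
   remains is a Boolean identity: the six cubic terms of the braiding are those of [F x y] and
   [F y x] together. *)
rewrite !oddD !oddM odd_double addbF addbACA => ->.
move: (odd (dot_exponent x y)) (odd (\sum_(i < 3) _)) => p q.
move: (odd (coord3 x 0)) (odd (coord3 x 1)) (odd (coord3 x 2)) => x1 x2 x3.
move: (odd (coord3 y 0)) (odd (coord3 y 1)) (odd (coord3 y 2)) => y1 y2 y3.
by case: x1 x2 x3 y1 y2 y3 p q => [] [] [] [] [] [] [] [].
Qed.

Theorem theorem1p3 (R : realType) :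
  braided_gr_category (coboundary2 (@oct_cochain R)) (@oct_braiding R) /\
  azumaya (coboundary2 (@oct_cochain R)) (@oct_braiding R) (octonions R).
Proof.
have coord0 i : coord3 0 i = 0%N by rewrite /coord3 mxE.
have F0x x : oct_cochain R 0 x = 1.
  rewrite /oct_cochain /oct_exponent !coord0 !(mul0n, muln0) /= big1 // => i _.
  by rewrite big1 // => j _; rewrite coord0.
have Fx0 x : oct_cochain R x 0 = 1.
  rewrite /oct_cochain /oct_exponent !coord0 !(mul0n, muln0) /= big1 // => i _.
  by rewrite big1 // => j _; rewrite coord0 muln0.
have F_neq0 x y : oct_cochain R x y != 0 by rewrite signr_eq0.
pose B x y : R := (-1) ^+ dot_exponent x y.
have B_neq0 x y : B x y != 0 by rewrite signr_eq0.
have BDl x y z : B (x + y) z = B x z * B y z by exact: signr_dotDl.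
have BC x y : B x y = B y x by rewrite /B dot_exponentC.
have BDr x y z : B x (y + z) = B x y * B x z.
  by rewrite BC BDl !(BC x).
have B_nondegr x : x != 0 -> exists y, B x y != 1.
  case/dot_exponent_nondeg=> y xy1; exists y.
  (* The value is -1, which differs from 1 because 2 is nonzero in [R]. *)
  by rewrite /B xy1 expr1 eq_sym -subr_eq0 opprK -[1 + 1]/(2%:R) pnatr_eq0.
have B_nondegl x : x != 0 -> exists y, B y x != 1.
  by move=> /B_nondegr[y yx]; exists y; rewrite BC.
have BrE : forall x y, _ := @oct_braidingE R.
split; first split.
- exact: coboundary2_cocycle.
- exact: twisted_quasi_bicharacter BrE.
- apply: twisted_group_algebra_azumaya BrE _ _ _ => //.
  by rewrite pnatr_eq0 -lt0n; apply/card_gt0P; exists 0.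
Qed.
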